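(* Let $G$ be a group acting on a set $X$, and suppose there are involutions $g\mapsto g^{\sigma}$ on the group $G$ (a group automorphism with square the identity) and $x\mapsto\sigma x$ on $X$ such that $\sigma(g(\sigma x))=(g^{\sigma})(x)$ for all $g\in G$, $x\in X$. Let $G^{\sigma}$ and $X^{\sigma}$ denote the fixed point sets of $\sigma$. Suppose further that: (1) $G$ is a subgroup of $M^{\times}$, the group of invertible elements of some finite-dimensional associative algebra $M$ over an algebraically closed field $\mathbf{k}$; (2) the anti-involution $g\mapsto g^*:=(g^{\sigma})^{-1}$ on $G$ extends to a $\mathbf{k}$-linear anti-involution $m\mapsto m^*$ of the algebra $M$; (3) for any $x\in X^{\sigma}$, the stabilizer $H=\mathrm{Stab}_G(x)$ is the group of invertible elements of its linear span $\mathrm{Span}_{\mathbf{k}}(H)$ in $M$. Then, if two points of $X^{\sigma}$ are $G$-conjugate, they are $G^{\sigma}$-conjugate.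
   Context: An anti-involution of an algebra (or group) is a map $m\mapsto m^*$ with $(mn)^*=n^*m^*$ and $(m^* )^*=m$. Two points are $G$-conjugate if they lie in the same $G$-orbit.
   Formalization: The field k is additionally assumed to have characteristic different from 2; in characteristic 2 the statement fails, e.g. for GL_2(k) with the transpose acting on cosets of the unit group of k[N], N the all-ones 2×2 matrix. *)

(* Defs.v *)
From HB Require Import structures.
From mathcomp Require Export all_boot all_order all_fingroup all_algebra all_field.
From mathcomp Require Export classical_sets.

Set Implicit Arguments.
Unset Strict Implicit.
Unset Printing Implicit Defensive.

Import GRing.Theory.
Local Open Scope classical_set_scope.
Local Open Scope ring_scope.

(* The action structures of the library are restricted to finite groups. *)
Record is_left_action (G : groupType) (X : Type) (act : G -> X -> X) : Prop := {
  left_action1 : forall x, act 1%g x = x;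
  left_actionM : forall g h x, act (g * h)%g x = act g (act h x)
}.

Definition fixed_points (T : Type) (f : T -> T) : set T := [set t | f t = t].

Definition stab (G : groupType) (X : Type) (act : G -> X -> X) (x : X) : set G :=
  [set g | act g x = x].

(* Meaningful when A is a subgroup of G. *)
Definition orbit_under (G : groupType) (X : Type) (act : G -> X -> X)
    (A : set G) (x : X) : set X :=
  [set act g x | g in A].

Definition conjugate_under (G : groupType) (X : Type) (act : G -> X -> X)
    (A : set G) (x y : X) : Prop :=
  exists z, orbit_under act A z x /\ orbit_under act A z y.

(* An identification of the abstract group G with a subgroup of the unit group
   of M; the values are units of M because G is a group. *)
Record unit_group_embedding (G : groupType) (M : unitRingType) (iota : G -> M)
    : Prop := {
  embedding_inj : injective iota;
  embedding1 : iota 1%g = 1;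
  embeddingM : forall g h, iota (g * h)%g = iota g * iota h
}.

Definition anti_involution (M : pzRingType) (star : M -> M) : Prop :=
  (forall m n, star (m * n) = star n * star m) /\ involutive star.

(* S may be infinite, whereas the library's span takes a finite sequence. *)
Definition lin_span (k : fieldType) (V : vectType k) (S : set V) : set V :=
  [set v | exists2 s : seq V, (forall u, u \in s -> S u) & v \in <<s>>%VS].

(* The inverse is required to lie in A as well. *)
Definition units_of (M : unitRingType) (A : set M) : set M :=
  [set m | [/\ A m, m \is a GRing.unit & A m^-1]].

(* Main.v *)
(* If [y = g x] with [x], [y] fixed by [sigma], then [s = g^* g] lies in the
   stabilizer [H] of [x] and is fixed by [*].  In odd characteristic or
   characteristic 0, an invertible element of a finite-dimensional algebra over
   an algebraically closed field has a square root [h = p(s)] that is a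
   polynomial in it.  Both [h] and [h^-1 = s^-1 p(s)] are linear combinations
   of powers of [s], so [h] is a unit of the span of [H], hence lies in [H];
   moreover [h^* = p(s^* ) = h].  Therefore [g h^-1] still maps [x] to [y], and
   [(g h^-1)^* (g h^-1) = h^-1 s h^-1 = 1] means that it is fixed by [sigma]. *)
Require Import Defs.
From mathcomp Require Import boolp ring.

Set Implicit Arguments.
Unset Strict Implicit.
Unset Printing Implicit Defensive.

Import GRing.Theory.
Local Open Scope classical_set_scope.
Local Open Scope ring_scope.

(* With [q] the current product, [p] is corrected to [p + t q]: the new root
   [a] imposes one equation [r(a) + 2 p(a) t + q(a) t^2 = 0] on the scalar [t].
   It is not constant in [t]: if [q(a) = 0] then [p(a)^2 = a] is nonzero. *)
Lemma sqrtX_mod_prod_XsubC (k : closedFieldType) (hchar : 2%N \notin [pchar k])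
    (rs : seq k) :
  0 \notin rs ->
  exists p : {poly k}, \prod_(z <- rs) ('X - z%:P) %| p ^+ 2 - 'X.
Proof.
elim: rs => [|a rs IHrs].
  by move=> _; exists 0; rewrite big_nil dvd1p.
rewrite inE negb_or eq_sym => /andP[a_neq0 /IHrs[p /dvdpP[r pX]]].
set q := \prod_(z <- rs) _ in pX.
have two_neq0 : 2%:R != 0 :> k by apply: contra hchar => two0; rewrite inE two0.
pose e : {poly k} := Poly [:: r.[a]; 2%:R * p.[a]; q.[a]].
have /closed_rootP[t /rootP] : size e != 1%N.
  apply/eqP => size_e.
  have e1 : e`_1 = 0 by rewrite nth_default ?size_e.
  have e2 : e`_2 = 0 by rewrite nth_default ?size_e.
  move: e1 e2; rewrite !coef_Poly /= => /eqP.
  rewrite mulf_eq0 (negPf two_neq0) /= => /eqP pa0 qa0.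
  have := congr1 (horner^~ a) pX.
  rewrite !hornerE pa0 qa0 mulr0 expr0n add0r => /eqP.
  by rewrite oppr_eq0 (negPf a_neq0).
rewrite horner_Poly /= mul0r add0r => et0.
exists (p + t *: q); rewrite big_cons -/q.
have -> : (p + t *: q) ^+ 2 - 'X = (r + 2%:R * t *: p + t ^+ 2 *: q) * q.
  have -> : 'X = p ^+ 2 - r * q by rewrite -pX opprB addrC subrK.
  by rewrite -!mul_polyC; ring.
apply: dvdp_mul => //; rewrite dvdp_XsubCl; apply/rootP.
by rewrite !hornerE -et0; ring.
Qed.

Lemma horner_algE (R : nzRingType) (A : algType R) (a : A) (p : {poly R}) :
  horner_alg a p = \sum_(i < size p) p`_i *: a ^+ i.
Proof.
rewrite -{1}[p]coefK poly_def linear_sum /=.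
by apply: eq_bigr => i _; rewrite linearZ /= mulr_algl rmorphXn /= horner_algX.
Qed.

(** With [n] the dimension of [M], the [n + 1] powers [1, a, ..., a ^+ n] are linearly dependent; a
    nontrivial relation gives the coefficients of [q]. *)
Lemma exists_annihilator (k : fieldType) (M : falgType k) (a : M) :
  exists2 q : {poly k}, q != 0 & horner_alg a q = 0.
Proof.
pose n := \dim {:M}.
pose P : n.+1.-tuple M := [tuple a ^+ i | i < n.+1].
have nfreeP : ~~ free P.
  by rewrite /free size_tuple neq_ltn ltnS dimvS ?subvf.
apply: contrapT => no_q; case/negP: nfreeP; apply/freeP => c c0 i.
apply: contrapT => ci; apply: no_q; exists (\poly_(j < n.+1) c (inord j)).
  apply/eqP => /(congr1 (fun q : {poly k} => q`_i)).
  by rewrite coef_poly ltn_ord coef0 inord_val.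
rewrite poly_def linear_sum /= -[RHS]c0.
apply: eq_bigr => j _; rewrite linearZ /= mulr_algl rmorphXn /= horner_algX inord_val.
by rewrite -(tnth_nth 0 P) tnth_mktuple.
Qed.

(** An annihilator of [s] that divides [p ^+ 2 - 'X] forces [p] to take at [s] a value whose square
    is [s]. It must have no root [0] for such a [p] to be available. *)
Lemma exists_sqrt_polynomial (k : closedFieldType)
    (hchar : 2%N \notin [pchar k]) (M : falgType k) (s : M) :
  s \is a GRing.unit -> exists p : {poly k}, horner_alg s p ^+ 2 = s.
Proof.
move=> s_unit; have [q q_neq0 qs0] := exists_annihilator s.
(* Write [q = q1 * 'X ^+ m] with [q1] nonzero at [0]. As [s ^+ m] is a unit, [q1] still annihilates
   [s]. *)
have [m [q1 + q_eq]] := multiplicity_XsubC q 0; rewrite q_neq0 /= => q1_0.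
have q1s0 : horner_alg s q1 = 0.
  apply: (mulIr (unitrX m s_unit)); rewrite mul0r -[RHS]qs0 q_eq subr0.
  by rewrite rmorphM rmorphXn /= horner_algX.
have [rs q1_eq] := closed_field_poly_normal q1.
have lead_neq0 : lead_coef q1 != 0.
  by rewrite lead_coef_eq0; apply: contraNneq q1_0 => ->; rewrite root0.
have [|p] := @sqrtX_mod_prod_XsubC k hchar rs.
  by move: q1_0; rewrite q1_eq rootZ // root_prod_XsubC.
rewrite -(dvdpZl _ _ lead_neq0) -q1_eq => /dvdpP[r pX]; exists p.
apply/eqP; rewrite -subr_eq0 -{2}[s]horner_algX -rmorphXn -rmorphB pX.
by rewrite rmorphM /= q1s0 mulr0.
Qed.

Lemma lin_span_sum (k : fieldType) (V : vectType k) (S : set V) (n : nat)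
    (c : 'I_n -> k) (f : 'I_n -> V) :
  (forall i, S (f i)) -> lin_span S (\sum_(i < n) c i *: f i).
Proof.
move=> Sf; exists [seq f i | i : 'I_n]; first by move=> u /mapP[i _ ->].
apply: memv_suml => i _; apply/memvZ/memv_span/map_f.
exact: mem_enum.
Qed.

Lemma anti_involution1 (M : pzRingType) (star : M -> M) :
  anti_involution star -> star 1 = 1.
Proof.
case=> starM starK.
(* Evaluate [star 1 * star (star 1)] in two ways. *)
by rewrite -[LHS]mulr1 -{2}[1]starK -starM mulr1 starK.
Qed.

Lemma anti_involutionX (M : pzRingType) (star : M -> M) (m : M) n :
  anti_involution star -> star (m ^+ n) = star m ^+ n.
Proof.
move=> star_anti; elim: n => [|n IHn]; first by rewrite !expr0 anti_involution1.
by rewrite exprS (proj1 star_anti) IHn -exprSr.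
Qed.

(** Powers of a single element commute, so the reversal of products is invisible and linearity
    concludes. *)
Lemma anti_involution_horner_alg (k : fieldType) (M : falgType k)
    (star : {linear M -> M}) (a : M) (p : {poly k}) :
  anti_involution star -> star (horner_alg a p) = horner_alg (star a) p.
Proof.
move=> star_anti; rewrite !horner_algE linear_sum /=.
by apply: eq_bigr => i _; rewrite linearZ /= anti_involutionX.
Qed.

Section UnitGroupEmbedding.
Variables (G : groupType) (M : unitRingType) (iota : G -> M).
Hypothesis hiota : unit_group_embedding iota.

Lemma embeddingX g n : iota (g ^+ n)%g = iota g ^+ n.
Proof.
elim: n => [|n IHn]; first by rewrite expr0 expg0 (embedding1 hiota).
by rewrite expgS exprS (embeddingM hiota) IHn.
Qed.

Lemma embedding_unit g : iota g \is a GRing.unit.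
Proof.
apply/unitrP; exists (iota g^-1%g).
by rewrite -!(embeddingM hiota) mulVg mulgV (embedding1 hiota).
Qed.

Lemma embeddingV g : iota g^-1%g = (iota g)^-1.
Proof.
apply: (mulIr (embedding_unit g)).
by rewrite mulVr ?embedding_unit // -(embeddingM hiota) mulVg (embedding1 hiota).
Qed.

End UnitGroupEmbedding.

Section StabilizerSubgroup.
Variables (G : groupType) (X : Type) (act : G -> X -> X).
Hypothesis hact : is_left_action act.

Lemma act_invP g x y : act g x = y -> act g^-1%g y = x.
Proof. by move=> <-; rewrite -(left_actionM hact) mulVg (left_action1 hact). Qed.

Lemma stabX g n x : stab act x g -> stab act x (g ^+ n)%g.
Proof.
rewrite /stab /= => gx; elim: n => [|n IHn].
  by rewrite expg0 (left_action1 hact).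
by rewrite expgS (left_actionM hact) IHn.
Qed.

End StabilizerSubgroup.

(** This brings the square root from [M] back into the stabilizer. The polynomial [p] is kept in the
    conclusion because invariance of [iota w] under [star] is read off from it. *)
Lemma stab_sqrt (G : groupType) (X : Type) (act : G -> X -> X)
    (hact : is_left_action act)
    (k : closedFieldType) (hchar : 2%N \notin [pchar k]) (M : falgType k)
    (iota : G -> M) (hiota : unit_group_embedding iota) (x : X) (u : G) :
  (let H := iota @` stab act x in H = units_of (lin_span H)) ->
  stab act x u ->
  exists w p, [/\ stab act x w, iota w = horner_alg (iota u) p & (w * w = u)%g].
Proof.
move=> /= Hx ux.
have u_unit := embedding_unit hiota u.
have [p p_sqr] := exists_sqrt_polynomial hchar u_unit.
set h := horner_alg (iota u) p in p_sqr.
have h_unit : h \is a GRing.unit by rewrite -(unitrX_pos h (n := 2)) ?p_sqr.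
(* This form makes [h^-1] a combination of the images of [u^-1 * u ^+ i], which all stabilize
   [x]. *)
have hV : h^-1 = (iota u)^-1 * h.
  by apply: (mulrI u_unit); rewrite mulVKr // -{1}p_sqr expr2 mulrK.
have : units_of (lin_span (iota @` stab act x)) h.
  split=> //.
    rewrite /h horner_algE; apply: lin_span_sum => i.
    by exists (u ^+ i)%g; [exact: stabX | rewrite embeddingX].
  rewrite hV /h horner_algE mulr_sumr.
  under eq_bigr => i _ do rewrite -scalerAr.
  apply: lin_span_sum => i; exists (u^-1 * u ^+ i)%g.
    rewrite /stab /= (left_actionM hact).
    by apply: (act_invP hact); rewrite ux; apply/esym/stabX.
  by rewrite (embeddingM hiota) (embeddingV hiota) embeddingX.
rewrite -Hx => -[w wx wh]; exists w, p; split=> //.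
by apply: (embedding_inj hiota); rewrite (embeddingM hiota) wh -expr2.
Qed.

Theorem proposition2p1
  (G : groupType) (X : Type) (act : G -> X -> X)
  (hact : is_left_action act)
  (sigmaG : {multiplicative G -> G}) (hsigmaG : involutive sigmaG)
  (sigmaX : X -> X) (hsigmaX : involutive sigmaX)
  (hsigma : forall (g : G) (x : X), sigmaX (act g (sigmaX x)) = act (sigmaG g) x)
  (k : closedFieldType) (hchar : 2%N \notin [pchar k])
  (M : falgType k)
  (iota : G -> M) (hiota : unit_group_embedding iota)
  (hstar : exists star : {linear M -> M},
     anti_involution star /\
     forall g : G, star (iota g) = iota (sigmaG g)^-1%g)
  (hstab : forall x : X, fixed_points sigmaX x ->
     let H := iota @` stab act x in
     H = units_of (lin_span H)) :
  forall x y : X, fixed_points sigmaX x -> fixed_points sigmaX y ->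
    conjugate_under act setT x y ->
    conjugate_under act (fixed_points sigmaG) x y.
Proof.
move=> x y fx fy [z [[a _ azx] [b _ bzy]]].
(* Both points come from the common base point [z], so [g] goes from [x] to [y] through [z]. *)
pose g := (b * a^-1)%g.
have gx : act g x = y by rewrite (left_actionM hact) (act_invP hact azx).
have sgx : act (sigmaG g) x = y by rewrite -hsigma fx gx fy.
have [star [star_anti star_iota]] := hstar.
have [starM starK] := star_anti.
pose u := ((sigmaG g)^-1 * g)%g.
have ux : stab act x u.
  by rewrite /stab /= (left_actionM hact) gx; apply: act_invP.
have u_star : star (iota u) = iota u.
  by rewrite (embeddingM hiota) -star_iota starM starK.
have [w [p [wx w_p w_sqr]]] := stab_sqrt hact hchar hiota (hstab x fx) ux.
have w_star : star (iota w) = iota w.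
  by rewrite w_p anti_involution_horner_alg // u_star.
pose r := (g * w^-1)%g.
have r_star : ((sigmaG r)^-1 * r = 1)%g.
  (* Multiplied by [w] on both sides, the claim becomes [g^* g = u]: since [star] fixes [iota w],
     the left factor [w] is absorbed into the star of [r * w = g]. *)
  apply: (mulgI w); apply: (mulIg w); rewrite mulg1 w_sqr.
  apply: (embedding_inj hiota); rewrite !(embeddingM hiota).
  rewrite -star_iota -{1}w_star mulrA -starM -mulrA -!(embeddingM hiota).
  by rewrite mulgVK star_iota -(embeddingM hiota).
have r_fixed : sigmaG r = r.
  by apply: (mulgI (sigmaG r)^-1%g); rewrite mulVg r_star.
have sigma1 : sigmaG 1%g = 1%g.
  by apply: (mulgI (sigmaG 1%g)); rewrite -gmulfM !mulg1.
(* The base point is now [x] itself, reached by the identity, which [sigmaG] fixes. *)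
exists x; split.
  by exists 1%g; [exact: sigma1 | exact: (left_action1 hact)].
by exists r; [exact: r_fixed | rewrite (left_actionM hact) (act_invP hact wx)].
Qed.
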